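(* Let $K$ be a field and let $\mathsf X$ be a nonempty one-sided subshift over a finite or countable alphabet. The following are equivalent: (1) the subshift algebra $\widetilde{\mathcal A}_K(\mathsf X)$ is locally finite, i.e. $\widetilde{\mathcal A}_K(\mathsf X)_m$ is finite-dimensional for every $m\in\mathbb Z$; (2) there exists $m\in\mathbb Z$ such that $\widetilde{\mathcal A}_K(\mathsf X)_m$ is finite-dimensional; (3) $\mathsf X$ is finite. In particular, under these equivalent conditions, the set $\mathcal L^1(\mathsf X)$ of letters (words of length one) appearing in points of $\mathsf X$ is finite.
   Context: Let $\mathscr A$ be a finite or countable alphabet and $\mathsf X\subseteq\mathscr A^{\mathbb N}$ a one-sided subshift (a subset closed for the product of discrete topologies with $\sigma(\mathsf X)\subseteq\mathsf X$), with shift $\sigma(x_0x_1x_2\cdots)=x_1x_2\cdots$. Let $\mathcal L_{\mathsf X}$ be the set of finite words appearing in points of $\mathsf X$, including the empty word $\omega$. For $\alpha,\beta\in\mathcal L_{\mathsf X}$ put $C(\alpha,\beta)=\{\beta x\in\mathsf X:\alpha x\in\mathsf X\}$; for a letter $a$ put $Z_a=\{x\in\mathsf X:x_0=a\}=C(\omega,a)$ and $F_a=\{y\in\mathsf X: ay\in\mathsf X\}$. Let $\mathcal U$ be the Boolean algebra of subsets of $\mathsf X$ generated by all $C(\alpha,\beta)$, and $\widehat{\mathcal U}$ its Stone space of ultrafilters, with topology generated by the sets $O_A=\{\xi\in\widehat{\mathcal U}:A\in\xi\}$, $A\in\mathcal U$. Let $\operatorname{dom}(\widehat\sigma)=\bigcup_{a\in\mathscr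 A}O_{Z_a}$ and, for $\xi\in O_{Z_a}$, let $\widehat\sigma(\xi)=\{B\in\mathcal U:\{y\in Z_a:\sigma(y)\in B\}\in\xi\}$; this is a local homeomorphism $\operatorname{dom}(\widehat\sigma)\to\widehat{\mathcal U}$, mapping $O_{Z_a}$ homeomorphically onto $O_{F_a}$. For a local homeomorphism $\tau:\operatorname{dom}(\tau)\to Y$ with $\operatorname{dom}(\tau)$ open in a totally disconnected locally compact Hausdorff space $Y$ (iterates having their natural domains, $\tau^0=\mathrm{id}_Y$), the Deaconu--Renault groupoid is $G(Y,\tau)=\{(x,k,y)\in Y\times\mathbb Z\times Y:\exists\,m,n\ge0,\ k=m-n,\ x\in\operatorname{dom}(\tau^m),\ y\in\operatorname{dom}(\tau^n),\ \tau^m(x)=\tau^n(y)\}$ with $r(x,k,y)=x$, $s(x,k,y)=y$, $(x,k,y)(y,\ell,z)=(x,k+\ell,z)$, $(x,k,y)^{-1}=(y,-k,x)$ and topology generated by the sets $\{(x,m-n,y):x\in U,y\in V,\tau^m(x)=\tau^n(y)\}$ with $U\subseteq\operatorname{dom}(\tau^m)$, $V\subseteq\operatorname{dom}(\tau^n)$ open and $\tau^m|_U,\tau^n|_V$ homeomorphisms onto their images. It is an ample Hausdorff groupoid, and its Steinberg algebra is $A_K(G(Y,\tau))=\mathrm{span}_K\{1_U:U\text{ a compact open bisection}\}$ with convolution product, $1_U*1_V=1_{UV}$ (a bisection is a set on which $r$ and $s$ are injective). The unital subshift algebra is $\widetilde{\mathcal A}_K(\mathsf X):=A_K(G(\widehat{\mathcal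 U},\widehat\sigma))$, with $\mathbb Z$-grading induced by $c(\xi,k,\eta)=k$: $\widetilde{\mathcal A}_K(\mathsf X)_m=\mathrm{span}_K\{1_U:U\subseteq c^{-1}(m)\text{ a compact open bisection}\}$. *)

(* Defs.v *)
From HB Require Import structures.
From mathcomp Require Import all_boot all_order all_algebra.
From mathcomp Require Import all_classical all_reals all_analysis.

Set Implicit Arguments.
Unset Strict Implicit.
Unset Printing Implicit Defensive.

Import Order.TTheory GRing.Theory Num.Theory.
Local Open Scope classical_set_scope.
Local Open Scope ring_scope.

Section Words.
Context {A : Type}.
Implicit Types (x : nat -> A) (w : seq A).

Definition shift x : nat -> A := fun n => x n.+1.

Definition pcons (a : A) x : nat -> A := fun n => if n is m.+1 then x m else a.

Definition wcat w x : nat -> A := foldr pcons x w.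

Lemma pconsK a : cancel (pcons a) shift.
Proof. by []. Qed.

Lemma pcons_shift x : pcons (x 0%N) (shift x) = x.
Proof. by apply/funext => -[]. Qed.

Lemma mkseq_wcat w x : mkseq (wcat w x) (size w) = w.
Proof.
elim: w => //= a w IH; rewrite /mkseq /= -[1%N]addn0 iotaDl -map_comp.
by congr cons; rewrite -[RHS]IH; apply: eq_map => i.
Qed.

End Words.

Record subshift (A : countType) := Subshift {
  points :> set (nat -> A);
  _ : closed (points : set (prod_topology (fun _ : nat => discrete_topology A)));
  subshift_shift : forall x, points x -> points (shift x) }.

Section BooleanAlgebra.
Context {T : Type} (X : set T).
Implicit Types (U F G : set (set T)).

Definition boolean_subalgebra F :=
  [/\ forall B, F B -> B `<=` X, F set0, setU_closed F
    & forall B, F B -> F (X `\` B)].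

(* Proper filters and ultrafilters of the Boolean algebra U (not of the power
   set of T, which is what [ProperFilter] and [UltraFilter] are about). *)
Definition proper_filter_of U F :=
  [/\ F `<=` U, F !=set0, ~ F set0, setI_closed F
    & forall B C, F B -> U C -> B `<=` C -> F C].

Definition ultrafilter_of U F :=
  proper_filter_of U F /\ forall G, proper_filter_of U G -> F `<=` G -> G = F.

Lemma boolean_subalgebra_smallest G : (forall B, G B -> B `<=` X) ->
  boolean_subalgebra (smallest boolean_subalgebra G).
Proof.
move=> GX; split.
- move=> B GB; apply: (GB [set C | C `<=` X]); split; last exact: GX.
  split=> //; first by move=> C D CX DX; rewrite /= subUset.
  by move=> C _; apply: subDsetl.
- by move=> F [[]].
- move=> B C FB FC F bF; have [[_ _ FU _] _] := bF; apply: (FU B C).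
    exact: (FB F bF).
  exact: (FC F bF).
- by move=> B FB F bF; have [[_ _ _ FD] _] := bF; apply: FD; apply: FB.
Qed.

Lemma boolean_subalgebraI F : boolean_subalgebra F -> setI_closed F.
Proof.
move=> [FX F0 FU FD] B C FB FC.
rewrite (_ : B `&` C = X `\` ((X `\` B) `|` (X `\` C))).
  by apply: (FD); apply: FU; apply: (FD).
apply/seteqP; split=> x.
  by move=> [Bx Cx]; split; [exact: FX Bx|case=> -[]].
move=> [Xx nx]; split; apply: contrapT => h; apply: nx; [left|right] => //.
Qed.

Lemma ultrafilter_ofC U F B : boolean_subalgebra U -> ultrafilter_of U F ->
  U B -> F B \/ F (X `\` B).
Proof.
move=> bU [[FU [B0 FB0] F0 FI Fup] Fmax] UB.
have [FB|nFB] := pselect (F B); [by left|right].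
have [UX _ _ UD] := bU.
pose G := [set C | U C /\ exists2 D, F D & D `&` B `<=` C].
have FG : F `<=` G by move=> C FC; split; [exact: FU|exists C => // x []].
have GB : G B by split=> //; exists B0 => // x [].
have [[_ [D FD DB]]|nG0] := pselect (G set0).
  apply: (Fup D) => //; first exact: UD.
  by move=> x Dx; split; [exact: UX (FU _ FD) _ Dx|move=> Bx; apply: (DB x)].
suff /Fmax/(_ FG) GF : proper_filter_of U G by move: GB; rewrite GF.
split=> //.
- by move=> C [].
- by exists B.
- move=> C C' [UC [D FD DC]] [UC' [D' FD' DC']]; split.
    exact: (boolean_subalgebraI bU).
  exists (D `&` D'); first exact: FI.
  by move=> x [[Dx D'x] Bx]; split; [apply: DC|apply: DC'].
- by move=> C C' [UC [D FD DC]] UC' CC'; split=> //; exists D => // x /DC /CC'.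
Qed.

End BooleanAlgebra.

Section StoneSpace.
Context {A : countType} (X : subshift A).
Implicit Types (alpha beta : seq A) (a : A).

Definition language : set (seq A) :=
  [set w | exists x i n, points X x /\ w = mkseq (fun j => x (i + j)%N) n].

Definition cset alpha beta : set (nat -> A) :=
  [set wcat beta x | x in [set x | points X (wcat beta x) /\ points X (wcat alpha x)]].

Definition zset a : set (nat -> A) := [set x | points X x /\ x 0%N = a].

Definition ualg : set (set (nat -> A)) :=
  smallest (boolean_subalgebra X)
    [set cset w.1 w.2 | w in language `*` language].

Definition stone := {xi : set (set (nat -> A)) | ultrafilter_of ualg xi}.

Definition stone_open (B : set (nat -> A)) : set stone :=
  [set xi | proj1_sig xi B].

HB.instance Definition _ := gen_eqMixin stone.
HB.instance Definition _ := gen_choiceMixin stone.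
HB.instance Definition _ := isSubBaseTopological.Build stone ualg stone_open.

Definition shat_dom : set stone := \bigcup_(a in [set: A]) stone_open (zset a).

Definition shat_set (xi : stone) : set (set (nat -> A)) :=
  [set B | ualg B /\ exists2 a, proj1_sig xi (zset a)
                              & proj1_sig xi (zset a `&` shift @^-1` B)].

Lemma ualg_boolean : boolean_subalgebra X ualg.
Proof.
by apply: boolean_subalgebra_smallest => _ [w _ <-] _ [x [Xx _] <-].
Qed.

Lemma ualg_cset alpha beta :
  language alpha -> language beta -> ualg (cset alpha beta).
Proof. by move=> La Lb F [_]; apply; exists (alpha, beta). Qed.

Lemma language_wcat beta x : points X (wcat beta x) -> language beta.
Proof. by exists (wcat beta x), 0%N, (size beta); rewrite mkseq_wcat. Qed.

Lemma ualg_zset_preim a alpha beta : language alpha ->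
  ualg (zset a `&` shift @^-1` cset alpha beta).
Proof.
move=> La; have [_ U0 _ _] := ualg_boolean.
have [Lab|nLab] := pselect (language (a :: beta)); last first.
  rewrite (_ : _ `&` _ = set0) // -subset0 => y [[Xy ya] [x _ sy]].
  apply: nLab; apply: (@language_wcat _ x).
  by rewrite /= sy -ya pcons_shift.
rewrite (_ : _ `&` _ = cset alpha (a :: beta)); first exact: ualg_cset.
apply/seteqP; split=> y.
  move=> [[Xy ya] [x [Xb Xa] sy]]; have ye : wcat (a :: beta) x = y.
    by rewrite /= sy -ya pcons_shift.
  by exists x => //; split=> //; rewrite ye.
move=> [x [Xb Xa] <-]; split=> //; exists x => //; split=> //.
exact: (@subshift_shift _ X _ Xb).
Qed.

Lemma ualg_zset a : ualg (zset a).
Proof.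
have [[x Xx]|X0] := pselect (exists x, points X x); last first.
  have [_ U0 _ _] := ualg_boolean.
  by rewrite (_ : zset a = set0) // -subset0 => y [Xy _]; apply: X0; exists y.
have L0 : language [::] by exists x, 0%N, 0%N.
rewrite (_ : zset a = zset a `&` shift @^-1` cset [::] [::]).
  exact: ualg_zset_preim.
apply/seteqP; split=> y; last by case.
move=> [Xy ya]; split=> //; exists (shift y) => //=.
by split; exact: subshift_shift.
Qed.

Lemma ualg_preim a B : ualg B -> ualg (zset a `&` shift @^-1` B).
Proof.
have bU := ualg_boolean; have [UX U0 UU UD] := bU.
pose F := [set B | B `<=` X /\ ualg (zset a `&` shift @^-1` B)].
move=> /(_ F) []//; split.
  split=> [C []//||C D [CX UC] [DX UD']|C [CX UC]].
  - by split; rewrite ?preimage_set0 ?setI0.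
  - split; first by rewrite subUset.
    by rewrite preimage_setU setIUr; apply: UU.
  - split; first exact: subDsetl.
    rewrite (_ : _ `&` _ = zset a `&` (X `\` (zset a `&` shift @^-1` C))).
      apply: (boolean_subalgebraI bU); first exact: ualg_zset.
      exact: UD.
    apply/seteqP; split=> y [Zy] [Xy nC].
      by split=> //; split; [case: Zy|case].
    split=> //; split; first exact: (subshift_shift Xy).
    by move=> Cy; apply: nC.
move=> _ [[al be] [/= La Lb] <-]; split; last exact: ualg_zset_preim.
by move=> _ [x [Xx _] <-].
Qed.

Lemma shat_setE xi a : proj1_sig xi (zset a) ->
  shat_set xi = [set B | ualg B /\ proj1_sig xi (zset a `&` shift @^-1` B)].
Proof.
have [[_ _ xi0 xiI _] _] := proj2_sig xi.
move=> xia; apply/seteqP; split=> B [UB]; last by move=> h; split=> //; exists a.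
move=> [b xib h]; split=> //; suff -> : a = b by [].
have [[y [[_ <-] [_ <-]]]|n] := pselect (zset a `&` zset b !=set0); first by [].
by case: xi0; have := xiI _ _ xia xib; move/nonemptyPn: n => ->.
Qed.

Lemma shat_ultrafilter xi : shat_dom xi -> ultrafilter_of ualg (shat_set xi).
Proof.
move=> [a _ xia]; rewrite (shat_setE xia).
have bU := ualg_boolean; have [UX U0 UU UD] := bU.
have xiu := proj2_sig xi; have [[xiU xin xi0 xiI xiup] _] := xiu.
split; first split.
- by move=> B [].
- exists (X `\` set0); split; first exact: UD.
  rewrite (_ : _ `&` _ = zset a) //; apply/seteqP; split=> y; first by case.
  by move=> [Xy ya]; do 2!split=> //; exact: subshift_shift.
- by move=> [_]; rewrite preimage_set0 setI0.
- move=> B C [UB xB] [UC xC]; split; first exact: (boolean_subalgebraI bU).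
  by rewrite preimage_setI setIIr; apply: xiI.
- move=> B C [UB xB] UC BC; split=> //.
  apply: xiup xB _ _; first exact: ualg_preim.
  by move=> y [? ?]; split=> //; apply: BC.
move=> G [GU _ G0 GI _] FG; apply/seteqP; split=> // B GB.
have UB := GU _ GB; split=> //.
have [//|xC] := ultrafilter_ofC bU xiu (@ualg_preim a _ UB).
case: G0; rewrite (_ : set0 = B `&` (X `\` B)); last first.
  by apply/esym; rewrite -subset0 => y [By [_]].
apply: GI => //; apply: FG; split; first exact: UD.
apply: (xiup _ _ (xiI _ _ xia xC)); first by apply: ualg_preim; exact: UD.
move=> y [Zy [Xy nB]]; split=> //; split; first exact: (subshift_shift Xy).
by move=> By; apply: nB.
Qed.

(* The value outside [shat_dom] is irrelevant: [dr_groupoid] only looks at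
   iterates of [shat] on their natural domains. *)
Definition shat (xi : stone) : stone :=
  if pselect (shat_dom xi) is left d then exist _ _ (shat_ultrafilter d) else xi.

End StoneSpace.

Definition homeo_onto_image (Y Z : topologicalType) (U : set Y) (f : Y -> Z) :=
  {within U, continuous f} /\
  exists g : Z -> Y, {within f @` U, continuous g} /\ {in U, cancel f g}.

Section DeaconuRenault.
(* A partial map is encoded by its domain D and a total extension tau. *)
Context (Y : topologicalType) (D : set Y) (tau : Y -> Y).

Definition iter_dom (m : nat) : set Y :=
  [set x | forall i, (i < m)%N -> D (iter i tau x)].

Record dr_groupoid := DRGroupoid {
  dr_r : Y;
  dr_c : int;
  dr_s : Y;
  _ : exists m n : nat, [/\ dr_c = m%:Z - n%:Z, iter_dom m dr_r,
        iter_dom n dr_s & iter m tau dr_r = iter n tau dr_s] }.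

Definition dr_basic (m n : nat) (U V : set Y) : set dr_groupoid :=
  [set g | [/\ U (dr_r g), V (dr_s g), dr_c g = m%:Z - n%:Z
             & iter m tau (dr_r g) = iter n tau (dr_s g)]].

Definition dr_subbase : set (set dr_groupoid) :=
  [set W | exists m n U V,
    [/\ open U /\ U `<=` iter_dom m, open V /\ V `<=` iter_dom n,
        homeo_onto_image U (iter m tau), homeo_onto_image V (iter n tau)
      & W = dr_basic m n U V]].

HB.instance Definition _ := gen_eqMixin dr_groupoid.
HB.instance Definition _ := gen_choiceMixin dr_groupoid.
HB.instance Definition _ := isSubBaseTopological.Build dr_groupoid dr_subbase id.

Definition compact_open_bisection (W : set dr_groupoid) :=
  [/\ compact W, open W, {in W &, injective dr_r} & {in W &, injective dr_s}].

End DeaconuRenault.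

Definition lspan (K : pzRingType) (V : lmodType K) (S : set V) : set V :=
  [set v | exists n (a : 'I_n -> K) (w : 'I_n -> V),
     (forall i, S (w i)) /\ v = \sum_(i < n) a i *: w i].

Definition finite_dimensional (K : pzRingType) (V : lmodType K) (E : set V) :=
  exists n (b : 'I_n -> V), E = lspan (range b).

(* The span of the 1_W for W a compact open bisection contained in P: the
   whole Steinberg algebra for P = setT, its homogeneous component of degree m
   for P = dr_c @^-1` [set m]. Only the vector space structure is recorded. *)
Definition steinberg (K : fieldType) (Y : topologicalType) (D : set Y)
    (tau : Y -> Y) (P : set (dr_groupoid D tau)) :
    set (dr_groupoid D tau -> K^o) :=
  lspan [set \1_W | W in [set W | compact_open_bisection W /\ W `<=` P]].

Definition subshift_algebra_component (K : fieldType) (A : countType)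
    (X : subshift A) (m : int) :
    set (dr_groupoid (@shat_dom A X) (@shat A X) -> K^o) :=
  steinberg (@dr_c _ _ _ @^-1` [set m]).
Arguments subshift_algebra_component : clear implicits.
Arguments subshift_algebra_component K {A} X m.

(* Main.v *)
Require Import Defs.
From mathcomp Require Import all_boot all_order all_algebra.
From mathcomp Require Import all_classical all_reals all_analysis.
Local Open Scope classical_set_scope.

Set Implicit Arguments.
Unset Strict Implicit.
Unset Printing Implicit Defensive.

Import Order.TTheory GRing.Theory Num.Theory.
Local Open Scope ring_scope.

(** Why finite-dimensionality of one graded component detects finiteness of X.

If X is finite, so are its Boolean algebra of subsets, the Stone space of that
algebra, and therefore the set of groupoid elements of a given degree m.  This
set then has only finitely many subsets, and the component of degree m is
spanned by finitely many indicator functions ([finite_dimensional_component]).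

Conversely, let X be infinite and m >= 0.  Any n points of X are told apart by
their prefixes of some common length N, which may be taken at least m
([prefix_separation]).  The ultrafilters containing the cylinder of such a
prefix form a compact open set, compact because a Stone space is compact
([stone_open_compact]).  On this set the m-th iterate of the shift of
ultrafilters is defined and is a homeomorphism onto its image
([iter_shat_homeo]): an ultrafilter is recovered from its m-th shift by putting
the first m letters back, and putting a letter back preserves the Boolean
algebra ([ualg_pcons]).  The graph of this iterate over the n compact open sets
gives n compact open bisections of degree m ([compact_open_bisection_graph]).
They are disjoint, and nonempty since each contains an element whose range is
the principal ultrafilter of the corresponding point.  Inversion of the
groupoid carries these bisections to degree -m ([compact_open_bisection_inv]),
so both signs are covered.  Indicators of disjoint nonempty sets are linearly
independent, hence the dimension of every component is at least n, for every n
([finite_dimensional_indic]). *)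

(** * Finite sets and finite-dimensional spaces *)

Lemma finite_set_range (T : Type) (E : set T) :
  finite_set E -> exists n (b : 'I_n -> T), E = range b.
Proof.
move=> /(@finite_seqP {classic T} E)[s sE]; exists (size s), (tnth (in_tuple s)).
rewrite sE; apply/seteqP; split=> x /=.
  by move=> /(@tnthP _ _ (in_tuple s))[i ->]; exists i.
by move=> [i _ <-]; apply: (@mem_tnth _ {classic T} i (in_tuple s)).
Qed.

Lemma finite_set_subsets (T : Type) (E : set T) :
  finite_set E -> finite_set [set B | B `<=` E].
Proof.
move=> /finite_set_range[n [b ->]].
pose img (J : {set 'I_n}) : set T := [set b i | i in [set` J]].
apply: (@sub_finite_set _ _ (range img)).
  move=> B BE; exists [set i | `[< B (b i) >]]%SET => //.
  rewrite /img; apply/seteqP; split=> x.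
    by move=> [i]; rewrite /= inE => /asboolP ? <-.
  move=> Bx; have [i _ bi] := BE _ Bx; exists i => //=.
  by rewrite inE; apply/asboolP; rewrite bi.
by apply: finite_image; apply: finite_finset.
Qed.

Section Lspan.
Context {K : pzRingType} {V : lmodType K}.

Lemma lspan_mem (S : set V) v : S v -> lspan S v.
Proof.
by move=> Sv; exists 1%N, (fun=> 1), (fun=> v); rewrite big_ord1 scale1r.
Qed.

Lemma lspan_range n (b : 'I_n -> V) v :
  lspan (range b) v -> exists c : 'I_n -> K, v = \sum_j c j *: b j.
Proof.
move=> [k [a [w [wb ->]]]].
have /choice[f fP] : forall i, exists j, b j = w i.
  by move=> i; have [j _ ?] := wb i; exists j.
exists (fun j => \sum_(i | f i == j) a i).
rewrite (partition_big f xpredT) //=; apply: eq_bigr => j _.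
by rewrite scaler_suml; apply: eq_bigr => i /eqP <-; rewrite fP.
Qed.

End Lspan.

(** The matrix of the values of the indicators [\1_(W i)] at the points [g j] is
the identity of size k; it factors through K^n, where n is the size of a
spanning family, so its rank k is at most n. *)
Lemma finite_dimensional_indic (K : fieldType) (T : Type) (E : set (T -> K^o)) :
  finite_dimensional E ->
  exists n, forall k (W : 'I_k -> set T) (g : 'I_k -> T),
    (forall i, E \1_(W i)) -> (forall i j, W i (g j) <-> i = j) -> (k <= n)%N.
Proof.
move=> [n [b ->]]; exists n => k W g EW Wg.
have /choice[c cP] i := lspan_range (EW i).
pose C := \matrix_(i < k, j < n) (c i j : K).
pose D := \matrix_(j < n, l < k) (b j (g l) : K).
suff : C *m D = 1%:M by apply: mulmx1_min.
apply/matrixP => i l; rewrite !mxE.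
transitivity ((\1_(W i) : T -> K^o) (g l) : K).
  by rewrite cP fct_sumE; apply: eq_bigr => j _; rewrite !mxE.
rewrite indicE; congr (_%:R); congr nat_of_bool.
by apply/idP/eqP; rewrite inE => /Wg.
Qed.

(** * Topologies given by a subbase *)

Section Subbase.
Context {T : topologicalType} {I : choiceType} (D : set I) (b : I -> set T).
Hypothesis openT :
  open = [set \bigcup_(B in D') B | D' in subset^~ (finI_from D b)].

Lemma subbase_open i : D i -> open (b i).
Proof.
move=> Di; rewrite openT /=; exists [set b i]; last by rewrite bigcup_set1.
by move=> _ ->; apply: finI_from1.
Qed.

Lemma subbase_cvg (F : set_system T) x : Filter F ->
  (forall i, D i -> b i x -> F (b i)) -> F --> x.
Proof.
move=> FF Fb W; rewrite nbhsE => -[U [+ Ux] UW]; rewrite openT /=.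
move=> [D' D'b UE]; move: Ux; rewrite -UE => -[B D'B Bx].
apply: (@filterS _ F _ B).
  by move=> y By; apply: UW; rewrite -UE; exists B.
have [J JD BE] := D'b _ D'B; rewrite -BE.
apply: filter_bigI => i iJ; apply: Fb; first by move/JD: iJ; rewrite inE.
by move: Bx; rewrite -BE; apply.
Qed.

End Subbase.

(** * The Stone space of the Boolean algebra of a subshift *)

Section Stone.
Context {A : countType} (X : subshift A).
Implicit Types (xi eta : stone X) (B C : set (nat -> A)).

Lemma stone_inj xi eta :
  (forall B, proj1_sig xi B <-> proj1_sig eta B) -> xi = eta.
Proof.
case: xi eta => [F uF] [G uG] /= FG; suff E : F = G.
  by case: G / E uG {FG} => uG; congr exist; apply: Prop_irrelevance.
by apply/funext => B; apply/propext.
Qed.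

Lemma stone_ualg xi B : proj1_sig xi B -> ualg X B.
Proof. by have [[FU _ _ _ _] _] := proj2_sig xi; apply: FU. Qed.

Lemma stoneS xi B C : proj1_sig xi B -> ualg X C -> B `<=` C -> proj1_sig xi C.
Proof. by have [[_ _ _ _ Fup] _] := proj2_sig xi; apply: Fup. Qed.

Lemma stoneI xi B C :
  proj1_sig xi B -> proj1_sig xi C -> proj1_sig xi (B `&` C).
Proof. by have [[_ _ _ FI _] _] := proj2_sig xi; apply: FI. Qed.

Lemma stone_set0 xi : ~ proj1_sig xi set0.
Proof. by have [[]] := proj2_sig xi. Qed.

(** The converse of [ultrafilter_ofC]: deciding every element of the algebra
forces maximality, which is how concrete ultrafilters are recognized below. *)
Lemma proper_filter_of_ultra (F : set (set (nat -> A))) :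
  proper_filter_of (ualg X) F ->
  (forall B, ualg X B -> F B \/ F (points X `\` B)) -> ultrafilter_of (ualg X) F.
Proof.
move=> pF FC; split=> // G [GU _ G0 GI _] FG; apply/seteqP; split=> // B GB.
have [//|/FG GXB] := FC B (GU _ GB); case: G0.
by have := GI _ _ GB GXB; rewrite setDE setIA (setIC B) -setIA setICr setI0.
Qed.

Lemma principal_ultrafilter x : points X x ->
  ultrafilter_of (ualg X) [set B | ualg X B /\ B x].
Proof.
move=> Xx; have bU := ualg_boolean X; have [UX U0 UU UD] := bU.
apply: proper_filter_of_ultra.
  split.
  - by move=> B [].
  - exists (points X `\` set0); split; [exact: UD|by split].
  - by move=> [_ []].
  - by move=> B C [UB Bx] [UC Cx]; split=> //; apply: (boolean_subalgebraI bU).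
  - by move=> B C [UB Bx] UC BC; split=> //; apply: BC.
move=> B UB; have [Bx|nBx] := pselect (B x); [by left|right].
by split=> //; apply: UD.
Qed.

Definition principal x (Xx : points X x) : stone X :=
  exist _ _ (principal_ultrafilter Xx).

Lemma stone_openP B : ualg X B -> open (stone_open B : set (stone X)).
Proof.
move=> UB.
exact: (@subbase_open (stone X) _ (ualg X) (fun B => stone_open B) erefl B).
Qed.

Lemma stone_cvg (F : set_system (stone X)) xi : Filter F ->
  (forall B, proj1_sig xi B -> F (stone_open B)) -> F --> xi.
Proof.
move=> FF h; apply: (@subbase_cvg (stone X) _ (ualg X)
   (fun B => stone_open B) erefl) => // B _; exact: h.
Qed.

(** An ultrafilter on the Stone space converges to the family of those B in the
algebra whose basic open set it contains; that family is an ultrafilter of the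
algebra because the basic open set of the complement of B is the complement. *)
Lemma stone_open_compact B : ualg X B -> compact (stone_open B : set (stone X)).
Proof.
move=> UB; rewrite compact_ultra => F UF FB.
have bU := ualg_boolean X; have [UX U0 UU UD] := bU.
pose xi0 := [set C | ualg X C /\ F (stone_open C : set (stone X))].
have uxi : ultrafilter_of (ualg X) xi0.
  apply: proper_filter_of_ultra.
    split.
    - by move=> C [].
    - by exists B.
    - by move=> [_ /filter_ex[xi /stone_set0]].
    - move=> C D [UC FC] [UD' FD]; split; first exact: (boolean_subalgebraI bU).
      by apply: filterS (filterI FC FD) => xi [] /stoneI; apply.
    - move=> C D [UC FC] UD' CD; split=> //.
      by apply: filterS FC => xi /stoneS; apply.
  move=> C UC; have [FC|FC] := in_ultra_setVsetC (stone_open C) UF; first by left.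
  right; split; first exact: UD.
  apply: filterS FC => xi nC.
  by have [/nC|] := ultrafilter_ofC bU (proj2_sig xi) UC.
exists (exist _ xi0 uxi); split; first by split.
by apply: stone_cvg => C [].
Qed.

(** * Iterates of the shift of ultrafilters on cylinders *)

(** The recursion peels off one letter at a time, in step with [iterSr], so that
membership in the Boolean algebra and the properties of the iterates of [shat]
are proved by induction on the length of the prefix. *)
Fixpoint cylinder x n : set (nat -> A) :=
  if n is n'.+1 then zset X (x 0%N) `&` Defs.shift @^-1` cylinder (Defs.shift x) n'
  else points X.

Lemma ualg_points : ualg X (points X).
Proof.
have [_ U0 _ UD] := ualg_boolean X.
by rewrite -(setD0 (points X)); apply: UD.
Qed.

Lemma ualg_cylinder x n : ualg X (cylinder x n).
Proof.
by elim: n x => [|n IHn] x; [exact: ualg_points|exact: ualg_preim].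
Qed.

Lemma cylinderP x n y :
  cylinder x n y <-> points X y /\ forall i, (i < n)%N -> y i = x i.
Proof.
elim: n x y => [|n IHn] x y /=; first by split=> [|[]].
split=> [[[Xy y0] /IHn[_ yx]]|[Xy yx]].
  by split=> // -[|i] //; apply: yx.
split; first by split=> //; apply: yx.
by apply/IHn; split=> [|i ?]; [exact: subshift_shift|exact: (yx i.+1)].
Qed.

Lemma cylinder_sub x m n : (m <= n)%N -> cylinder x n `<=` cylinder x m.
Proof.
move=> mn y /cylinderP[Xy yx]; apply/cylinderP; split=> // i im.
by apply: yx; apply: leq_trans mn.
Qed.

Lemma ualg_cset_words s t : ualg X (cset X s t).
Proof.
have [[Ls Lt]|nL] := pselect (language X s /\ language X t).
  exact: ualg_cset.
have [_ U0 _ _] := ualg_boolean X.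
rewrite (_ : cset _ _ _ = set0) // -subset0 => z [y [Xt Xs] zE].
by apply: nL; split; [exact: language_wcat Xs|exact: language_wcat Xt].
Qed.

(** Stability of the algebra under removing a first letter.  Only a generator
C(s, t) needs an argument.  If t is empty, prepending a to a point y keeps it in
C(s, t) when both ay and say are in X; if t begins with a, the condition is that
ay is in X and y is in C(s, t') for the tail t' of t; otherwise no y works. *)
Lemma ualg_pcons a B : ualg X B -> ualg X (points X `&` pcons a @^-1` B).
Proof.
have bU := ualg_boolean X; have [UX U0 UU UD] := bU.
pose F := [set B | B `<=` points X /\ ualg X (points X `&` pcons a @^-1` B)].
have UXa : ualg X (points X `&` pcons a @^-1` points X).
  rewrite (_ : _ `&` _ = cset X [:: a] [::]); first exact: ualg_cset_words.
  apply/seteqP; split=> y /=.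
    by move=> [? ?]; exists y.
  by move=> [z [? ?] <-].
move=> /(_ F) []//; split.
  split=> [C []//||C D [CX UC] [DX UD']|C [CX UC]].
  - by split; rewrite ?preimage_set0 ?setI0.
  - split; first by rewrite subUset.
    by rewrite preimage_setU setIUr; apply: UU.
  - split; first exact: subDsetl.
    rewrite (_ : _ `&` _ = (points X `&` pcons a @^-1` points X) `&`
       (points X `\` (points X `&` pcons a @^-1` C))).
      by apply: (boolean_subalgebraI bU) => //; apply: UD.
    apply/seteqP; split=> y.
      by move=> [Xy [Xa nC]]; do 2!split=> //; case.
    by move=> [[Xy Xa] [_ nC]]; do 2!split=> //; move=> Cy; apply: nC.
move=> _ [[s t] _ <-]; split; first by move=> _ [y [Xy _] <-].
rewrite /=; case: t => [|b t].
  rewrite (_ : _ `&` _ = (points X `&` pcons a @^-1` points X) `&`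
       cset X (rcons s a) [::]).
    apply: (boolean_subalgebraI bU) => //; exact: ualg_cset_words.
  have wr y : wcat (rcons s a) y = wcat s (pcons a y).
    by rewrite /wcat foldr_rcons.
  apply/seteqP; split=> y /=.
    move=> [Xy [z /= [Xz Xs] zy]]; subst z; split; first by split.
    by exists y => //; rewrite /= wr.
  move=> [[Xy Xa]] [z /= [Xz Xs] zy]; subst z; split=> //.
  by exists (pcons a y) => //=; rewrite -wr.
have [<-|nab] := pselect (a = b); last first.
  rewrite (_ : _ `&` _ = set0) // -subset0 => y [_] [z _] /(congr1 (@^~ 0%N)).
  by move=> /= /esym /nab.
rewrite (_ : _ `&` _ = (points X `&` pcons a @^-1` points X) `&` cset X s t).
  apply: (boolean_subalgebraI bU) => //; exact: ualg_cset_words.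
apply/seteqP; split=> y /=.
  move=> [Xy [z /= [Xt Xs] zy]].
  have {}zy : wcat t z = y by rewrite -(pconsK a y) -zy.
  split; first by split=> //; rewrite -zy.
  by exists z => //; split=> //; rewrite zy.
move=> [[Xy Xa]] [z [Xt Xs] zy]; split=> //; exists z => /=; last by rewrite zy.
by rewrite zy.
Qed.

Lemma shat_zset xi a B : proj1_sig xi (zset X a) -> ualg X B ->
  proj1_sig (shat xi) B <-> proj1_sig xi (zset X a `&` Defs.shift @^-1` B).
Proof.
move=> xia UB; rewrite /shat; case: pselect => [d|[]]; last by exists a.
rewrite /= (shat_setE xia); split=> [[]//|xB]; by split.
Qed.

Lemma shat_cylinder xi x n : proj1_sig xi (cylinder x n.+1) ->
  proj1_sig xi (zset X (x 0%N)) /\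
  proj1_sig (shat xi) (cylinder (Defs.shift x) n).
Proof.
move=> xiC; have xia : proj1_sig xi (zset X (x 0%N)).
  by apply: stoneS xiC _ _; [exact: ualg_zset|move=> y []].
by split=> //; apply/(shat_zset xia) => //; apply: ualg_cylinder.
Qed.

Lemma iter_shat_dom xi x n : proj1_sig xi (cylinder x n) ->
  iter_dom (@shat_dom _ X) (@shat _ X) n xi.
Proof.
elim: n xi x => [|n IHn] xi x // /shat_cylinder[xia sxi].
case=> [|i] lin; first by exists (x 0%N).
by rewrite iterSr; apply: (IHn _ _ sxi).
Qed.

(** This is the continuity of the n-th iterate on a cylinder, at the level of the
basic open sets; [iter_shat_image] is that of its inverse. *)
Lemma iter_shat_preim x n B : ualg X B -> exists2 C, ualg X C &
  forall xi, proj1_sig xi (cylinder x n) ->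
    proj1_sig (iter n (@shat _ X) xi) B <-> proj1_sig xi C.
Proof.
move=> UB; elim: n x => [|n IHn] x; first by exists B.
have [C UC CP] := IHn (Defs.shift x).
exists (zset X (x 0%N) `&` Defs.shift @^-1` C); first exact: ualg_preim.
move=> xi /shat_cylinder[xia sxi].
by rewrite iterSr (CP (shat xi)) //; exact: shat_zset.
Qed.

(** On the ultrafilters starting with the letter a, the shift sends the basic open
set of B to that of the set of all y such that ay is in B. *)
Lemma iter_shat_image x n B : ualg X B -> exists2 C, ualg X C &
  forall xi, proj1_sig xi (cylinder x n) ->
    proj1_sig xi B <-> proj1_sig (iter n (@shat _ X) xi) C.
Proof.
elim: n x B => [|n IHn] x B UB; first by exists B.
pose B1 := points X `&` pcons (x 0%N) @^-1` B.
have UB1 : ualg X B1 by apply: ualg_pcons.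
have [C UC CP] := IHn (Defs.shift x) _ UB1; exists C => //.
move=> xi /shat_cylinder[xia sxi]; rewrite iterSr -(CP (shat xi)) //.
have sB1 : zset X (x 0%N) `&` Defs.shift @^-1` B1 = zset X (x 0%N) `&` B.
  apply/seteqP; split=> y [[Xy y0]].
    by move=> [_ /=]; rewrite -y0 pcons_shift.
  move=> By; split=> //; split; first exact: subshift_shift.
  by rewrite /= -y0 pcons_shift.
rewrite (shat_zset xia UB1) sB1; split=> [xB|xB]; first exact: stoneI.
by apply: stoneS xB UB _ => y [].
Qed.

Lemma iter_shat_inj x n xi eta : proj1_sig xi (cylinder x n) ->
  proj1_sig eta (cylinder x n) ->
  iter n (@shat _ X) xi = iter n (@shat _ X) eta -> xi = eta.
Proof.
move=> xiC etaC E; apply: stone_inj => B.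
have [UB|nUB] := pselect (ualg X B).
  by have [C _ CP] := iter_shat_image x n UB; rewrite (CP xi) // (CP eta) // E.
by split=> /stone_ualg.
Qed.

Lemma iter_shat_cont x n :
  {within stone_open (cylinder x n), continuous (iter n (@shat _ X))}.
Proof.
apply/subspace_continuousP => xi xiC; apply: stone_cvg => B xiB.
have [C UC CP] := iter_shat_preim x n (stone_ualg xiB).
have := open_nbhs_nbhs (conj (stone_openP UC) (proj1 (CP _ xiC) xiB)).
by apply: filterS => eta etaC etaZ; apply/(CP eta).
Qed.

Lemma iter_shat_homeo x n :
  homeo_onto_image (stone_open (cylinder x n)) (iter n (@shat _ X)).
Proof.
split; first exact: iter_shat_cont.
set f := iter n _; set U := stone_open _.
have /choice[g gP] eta : exists xi, (f @` U) eta -> U xi /\ f xi = eta.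
  have [[xi ? ?]|nU] := pselect ((f @` U) eta); first by exists xi.
  by exists eta.
exists g; split; last first.
  move=> xi; rewrite inE => xiU.
  have [gU fg] := gP (f xi) (imageP _ xiU).
  exact: iter_shat_inj gU xiU fg.
apply/subspace_continuousP => eta etaU; apply: stone_cvg => B gB.
have [C UC CP] := iter_shat_image x n (stone_ualg gB).
have [gU fg] := gP _ etaU.
have etaC : proj1_sig eta C by rewrite -fg; apply/(CP (g eta)).
have := open_nbhs_nbhs (conj (stone_openP UC) etaC).
apply: filterS => zeta zetaC zetaU; have [gzU fgz] := gP _ zetaU.
by apply/(CP (g zeta)) => //; rewrite -/f fgz.
Qed.

End Stone.

(** * Compact open bisections of a Deaconu-Renault groupoid *)

Section Groupoid.
Context {Y : topologicalType} {D : set Y} {tau : Y -> Y}.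
Local Notation G := (dr_groupoid D tau).
Implicit Types (g h : G) (W : set G).

Lemma dr_groupoid_inj g h :
  dr_r g = dr_r h -> dr_c g = dr_c h -> dr_s g = dr_s h -> g = h.
Proof.
case: g h => [x k y p] [x' k' y' p'] /= ex ek ey; subst x' k' y'.
by congr DRGroupoid; apply: Prop_irrelevance.
Qed.

Lemma dr_subbase_open W : dr_subbase W -> open W.
Proof.
by move=> GW; exact: (@subbase_open G _ (@dr_subbase Y D tau) id erefl W GW).
Qed.

Lemma dr_groupoid_cvg (F : set_system G) g : Filter F ->
  (forall W, dr_subbase W -> W g -> F W) -> F --> g.
Proof.
by move=> FF FW; apply: (@subbase_cvg G _ (@dr_subbase Y D tau) id erefl).
Qed.

Lemma dr_inv_subproof g : exists m n : nat, [/\ - dr_c g = m%:Z - n%:Z,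
  iter_dom D tau m (dr_s g), iter_dom D tau n (dr_r g)
  & iter m tau (dr_s g) = iter n tau (dr_r g)].
Proof.
case: g => x k y [m [n [kE xm yn E]]]; exists n, m.
by split; rewrite //= kE opprB.
Qed.

Definition dr_inv g : G := DRGroupoid (dr_inv_subproof g).

Lemma dr_invK : involutive dr_inv.
Proof. by move=> g; apply: dr_groupoid_inj => //=; rewrite opprK. Qed.

Lemma dr_inv_continuous : continuous dr_inv.
Proof.
move=> g; apply: dr_groupoid_cvg => [|W].
  by apply: fmap_filter; apply: nbhs_filter.
move=> [m [n [U [V [oU oV hU hV ->]]]]] gW.
change (nbhs g (dr_inv @^-1` dr_basic m n U V)).
suff <- : dr_basic n m V U = dr_inv @^-1` dr_basic m n U V.
  apply: open_nbhs_nbhs; split.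
    by apply: dr_subbase_open; exists n, m, V, U.
  by case: gW => [Us Vr gc gE]; split=> //; apply: oppr_inj; rewrite opprB.
apply/seteqP; split=> h [hU' hV' hc hE]; split=> //=; first by rewrite hc opprB.
by apply: oppr_inj; rewrite opprB.
Qed.

Lemma compact_open_bisection_inv W :
  compact_open_bisection W -> compact_open_bisection (dr_inv @^-1` W).
Proof.
move=> [cW oW rW sW]; split.
- rewrite (_ : _ @^-1` _ = dr_inv @` W).
    apply: continuous_compact => //; apply: continuous_subspaceT.
    exact: dr_inv_continuous.
  apply/seteqP; split=> g; last by move=> [h Wh <-]; rewrite /= dr_invK.
  by exists (dr_inv g) => //; rewrite dr_invK.
- by apply: open_comp => // g _; apply: dr_inv_continuous.
- move=> g h; rewrite !inE => gW hW E; apply: (inv_inj dr_invK).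
  by apply: sW; rewrite ?inE.
- move=> g h; rewrite !inE => gW hW E; apply: (inv_inj dr_invK).
  by apply: rW; rewrite ?inE.
Qed.

(** Stated for all x, with the domain condition inside the existential, so that
choice yields a total function: elements of the groupoid carry a proof of
membership and cannot be formed off the domain. *)
Lemma dr_graph_point m x : exists g : G,
  iter_dom D tau m x -> [/\ dr_r g = x, dr_c g = m & dr_s g = iter m tau x].
Proof.
have [xm|nxm] := pselect (iter_dom D tau m x).
  have p : exists p q : nat, [/\ m%:Z = p%:Z - q%:Z, iter_dom D tau p x,
     iter_dom D tau q (iter m tau x) & iter p tau x = iter q tau (iter m tau x)].
    by exists m, 0%N; rewrite subr0; split.
  by exists (DRGroupoid p).
have p : exists p q : nat, [/\ 0 = p%:Z - q%:Z, iter_dom D tau p x,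
   iter_dom D tau q x & iter p tau x = iter q tau x].
  by exists 0%N, 0%N; rewrite subr0; split.
by exists (DRGroupoid p).
Qed.

(** The set is the image of U under x |-> (x, m, tau^m x).  This map is continuous
for the subbase: a basic set of type (p, q) with p - q = m pulls back to the
conditions that x be in one open set and tau^m x in another, since
tau^p x = tau^q (tau^m x) holds automatically. *)
Lemma compact_open_bisection_graph (U : set Y) m :
  open U -> compact U -> U `<=` iter_dom D tau m ->
  homeo_onto_image U (iter m tau) ->
  compact_open_bisection (dr_basic m 0 U setT : set G).
Proof.
move=> oU cU Um hU; have [fU [f' [_ f'K]]] := hU.
have /choice[h hP] x : exists g : G, iter_dom D tau m x ->
    [/\ dr_r g = x, dr_c g = m & dr_s g = iter m tau x].
  exact: dr_graph_point.
have Wr (g : G) : dr_basic m 0 U setT g ->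
    dr_c g = m /\ dr_s g = iter m tau (dr_r g).
  by move=> [_ _ -> ->]; rewrite subr0.
split.
- rewrite (_ : dr_basic _ _ _ _ = h @` U).
    apply: continuous_compact cU.
    apply/subspace_continuousP => x Ux; apply: dr_groupoid_cvg.
    move=> _ [p [q [U1 [V1 [[oU1 U1p] [oV1 V1q] _ _ ->]]]]] [].
    have [-> -> ->] := hP x (Um _ Ux) => U1x V1x mpq Epq.
    have pmq : p = (q + m)%N.
      by apply/eqP; rewrite -eqz_nat PoszD mpq addrC subrK.
    have nU1 := open_nbhs_nbhs (conj oU1 U1x).
    move/subspace_continuousP/(_ x Ux V1 (open_nbhs_nbhs (conj oV1 V1x))) : fU.
    apply: filterS2 nU1 => y U1y V1y Uy.
    have [hr hc hs] := hP y (Um _ Uy); split; rewrite ?hr ?hs ?hc //.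
      exact: V1y.
    by rewrite pmq iterD.
  apply/seteqP; split=> g.
    move=> Wg; have [gc gs] := Wr _ Wg; have [Ug _ _ _] := Wg.
    have [hr hc hs] := hP _ (Um _ Ug).
    by exists (dr_r g) => //; apply: dr_groupoid_inj; rewrite ?hr ?hc ?hs.
  move=> [x Ux <-]; have [hr hc hs] := hP _ (Um _ Ux).
  by split; rewrite ?hr ?hc ?hs ?subr0.
- apply: dr_subbase_open; exists m, 0%N, U, setT; split => //.
    by split; [exact: openT|].
  split; first by apply: continuous_subspaceT => x; exact: cvg_id.
  by exists id; split=> //; apply: continuous_subspaceT => x; exact: cvg_id.
- move=> g g'; rewrite !inE => /Wr[gc gs] /Wr[gc' gs'] E.
  by apply: dr_groupoid_inj; rewrite ?gc ?gc' ?gs ?gs' ?E.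
- move=> g g'; rewrite !inE => Wg Wg' E.
  have [[gc gs] [gc' gs']] := (Wr _ Wg, Wr _ Wg').
  have [[Ug _ _ _] [Ug' _ _ _]] := (Wg, Wg').
  apply: dr_groupoid_inj; rewrite ?gc ?gc' //.
  by rewrite -(f'K (dr_r g)) ?inE // -gs E gs' f'K // inE.
Qed.

End Groupoid.

(** * Graded components and finiteness of the subshift *)

Section Component.
Context {A : countType} (X : subshift A).
Local Notation G := (dr_groupoid (@shat_dom A X) (@shat A X)).

Lemma finite_stone : finite_set (points X) -> finite_set [set: stone X].
Proof.
move=> fX; have fU : finite_set (ualg X).
  apply: sub_finite_set (finite_set_subsets fX) => B UB.
  by have [UX _ _ _] := ualg_boolean X; apply: UX.
rewrite (_ : setT =
  (@proj1_sig _ _ : stone X -> _) @^-1` [set F | F `<=` ualg X]).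
  apply: finite_preimage (finite_set_subsets fU) => xi eta _ _ E.
  by apply: stone_inj => B; rewrite E.
by apply/seteqP; split=> // xi _ B; apply: stone_ualg.
Qed.

Lemma finite_dr_component m : finite_set (points X) ->
  finite_set (@dr_c _ _ _ @^-1` [set m] : set G).
Proof.
move=> /finite_stone fS.
pose f (g : G) := (dr_r g, dr_c g, dr_s g).
rewrite (_ : _ @^-1` _ = f @^-1` ([set: stone X] `*` [set m] `*` [set: stone X])).
  apply: finite_preimage; first by move=> g h _ _ [*]; apply: dr_groupoid_inj.
  by apply: finite_setX => //; apply: finite_setX.
by apply/seteqP; split=> g /=; [|case=> -[]].
Qed.

Lemma finite_dimensional_component (K : fieldType) m : finite_set (points X) ->
  finite_dimensional (subshift_algebra_component K X m).
Proof.
move=> /(finite_dr_component m) fG.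
rewrite /finite_dimensional /subshift_algebra_component /steinberg.
set S := [set _ | _ in _]; suff /finite_set_range[n [b ->]] : finite_set S.
  by exists n, b.
apply: finite_image; apply: sub_finite_set (finite_set_subsets fG).
by move=> W [].
Qed.

Lemma prefix_separation n (x : 'I_n -> nat -> A) : injective x ->
  exists N, forall i j, (forall k, (k < N)%N -> x j k = x i k) -> i = j.
Proof.
move=> xI.
have /choice[d dP] (p : 'I_n * 'I_n) :
    exists k, p.1 <> p.2 -> x p.2 k <> x p.1 k.
  have [xE|] := pselect (exists k, x p.2 k <> x p.1 k).
    by have [k ?] := xE; exists k.
  move=> /forallNP xE; exists 0%N => pE; exfalso; apply: pE; apply: xI.
  by apply/funext => k; apply/esym; apply: contrapT.
(* beyond the largest of the positions d (i, j) where x i and x j differ *)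
exists (\max_p d p).+1 => i j xij; apply: contrapT => ij.
apply: (dP (i, j) ij); apply: xij; rewrite ltnS.
exact: (leq_bigmax (i, j)).
Qed.

(** The dual family of an infinite subshift in degree m >= 0: graphs of the m-th
iterate over cylinders of n separated points, and the elements of these graphs
above the principal ultrafilters of the points. *)
Lemma separating_graphs m n : ~ finite_set (points X) ->
  exists (W : 'I_n -> set G) (g : 'I_n -> G),
  [/\ forall i, compact_open_bisection (W i),
      forall i h, W i h -> dr_c h = m%:Z
    & forall i j, W i (g j) <-> i = j].
Proof.
move=> nfX; have [x0 _] := infinite_setN0 nfX.
have [B BX nB] := infinite_set_fset n nfX.
pose x (i : 'I_n) := nth x0 (finmap.enum_fset B) i.
have xB (i : 'I_n) : (i < size (finmap.enum_fset B))%N by apply: leq_trans nB.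
have xX i : points X (x i) by apply: BX; apply: mem_nth.
have xI : injective x.
  move=> i j /eqP; rewrite nth_uniq ?xB ?finmap.fset_uniq // => /eqP.
  exact: val_inj.
have [N0 NP] := prefix_separation xI; pose N := maxn N0 m.
(* N >= N0 makes the cylinders disjoint, and on a cylinder of length N >= m the
   m-th iterate is defined and injective. *)
pose U i : set (stone X) := stone_open (cylinder X (x i) N).
have UM i xi : U i xi -> proj1_sig xi (cylinder X (x i) m).
  have mN : (m <= N)%N by rewrite leq_maxr.
  move=> xiN; apply: (stoneS xiN); first exact: ualg_cylinder.
  exact: cylinder_sub mN.
have Ucob i : compact_open_bisection (dr_basic m 0 (U i) setT : set G).
  apply: compact_open_bisection_graph.
  - by apply: stone_openP; apply: ualg_cylinder.
  - by apply: stone_open_compact; apply: ualg_cylinder.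
  - by move=> xi /UM; apply: iter_shat_dom.
  have [cf [f' [cf' f'K]]] := iter_shat_homeo X (x i) m; split.
    by apply: continuous_subspaceW cf => xi /UM.
  exists f'; split.
    by apply: continuous_subspaceW cf'; apply: image_subset => xi /UM.
  by move=> xi; rewrite inE => /UM xiU; apply: f'K; rewrite inE.
have UI i j : U i (principal (xX j)) <-> i = j.
  rewrite /U /=; split=> [[_ /cylinderP[_ h]]|<-].
    by apply: NP => k kN; apply: h; apply: leq_trans kN (leq_maxl _ _).
  by split; [exact: ualg_cylinder|apply/cylinderP].
have /choice[g gP] i :
    exists g : G, dr_basic m 0 (U i) setT g /\ dr_r g = principal (xX i).
  have UI' : U i (principal (xX i)) by apply/UI.
  have [g gP] := @dr_graph_point _ (@shat_dom A X) (@shat A X) m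
    (principal (xX i)).
  have [gr gc gs] := gP (iter_shat_dom (UM i _ UI')).
  by exists g; split=> //; split; rewrite ?gr ?gc ?gs ?subr0.
exists (fun i => dr_basic m 0 (U i) setT), g; split=> //.
  by move=> i h [_ _ -> _]; rewrite subr0.
move=> i j; split; last by move=> ->; apply: (gP j).1.
by move=> [+ _ _ _]; rewrite (gP j).2 => /UI.
Qed.

Lemma separating_bisections (m : int) n : ~ finite_set (points X) ->
  exists (W : 'I_n -> set G) (g : 'I_n -> G),
  [/\ forall i, compact_open_bisection (W i),
      forall i h, W i h -> dr_c h = m
    & forall i j, W i (g j) <-> i = j].
Proof.
case: m => m nfX; first exact: separating_graphs.
have [W [g [cW Wm Wg]]] := separating_graphs m.+1 n nfX.
exists (fun i => dr_inv @^-1` W i), (dr_inv \o g); split.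
- by move=> i; apply: compact_open_bisection_inv.
- by move=> i h /Wm /= hm; rewrite -[LHS]opprK hm NegzE.
- by move=> i j; rewrite /= dr_invK.
Qed.

Lemma finite_component_finite (K : fieldType) m :
  finite_dimensional (subshift_algebra_component K X m) -> finite_set (points X).
Proof.
move=> /finite_dimensional_indic[n nP]; apply: contrapT => nfX.
have [W [g [cW Wm Wg]]] := separating_bisections m n.+1 nfX.
suff : (n.+1 <= n)%N by rewrite ltnn.
apply: nP Wg => i; apply: lspan_mem; exists (W i) => //; split=> //.
by move=> h /Wm.
Qed.

Lemma finite_letters : finite_set (points X) ->
  finite_set [set a : A | language X [:: a]].
Proof.
move=> fX; apply: sub_finite_set (finite_image (fun x => x 0%N) fX).
move=> a [x [i [[|[|n]] [Xx] //= [->]]]].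
exists (iter i Defs.shift x).
  by elim: i => //= i; apply: subshift_shift.
rewrite addn0.
suff E j : iter i Defs.shift x j = x (i + j)%N by rewrite E addn0.
by elim: i j => //= i IH j; rewrite /Defs.shift IH addnS.
Qed.

End Component.

Theorem theorem6p24 (K : fieldType) (A : countType) (X : subshift A)
    (X_neq0 : points X !=set0) :
  [<-> (forall m : int, finite_dimensional (subshift_algebra_component K X m));
       (exists m : int, finite_dimensional (subshift_algebra_component K X m));
       finite_set (points X)] /\
  (finite_set (points X) -> finite_set [set a : A | language X [:: a]]).
Proof.
split; last exact: finite_letters.
tfae; first by move=> h; exists 0.
  by move=> [m]; apply: finite_component_finite.
by move=> fX m; apply: finite_dimensional_component.
Qed.
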